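(* Let $T$ be a Bienaymé–Galton–Watson tree whose offspring distribution $L$ satisfies $\mathbb{E}[L]=m\in(1,\infty)$. For any $\theta\in[0,1]$ with $\theta\le\frac{1}{em}$, \[\mathbb{P}(\text{there exists an infinite increasing path})=0,\] and \[\limsup_{h\to\infty}\frac1h\log\mathbb{P}(\text{there exists an increasing path of length}\ge h\text{ starting from }\rho)\le\log(em\theta).\]
   Context: Rough Mount Fuji labels: given a rooted tree with vertex set $V$, root $\rho$ and graph distance $d$, and $\theta\in[0,1]$, let $\{U_v:v\in V\}$ be i.i.d. Uniform$(0,1)$, independent of the tree, and set $X_v=U_v+\theta\,d(\rho,v)$. A (finite or infinite) simple path $\rho=v_0,v_1,\ldots$ from the root is increasing if $X_{v_0}<X_{v_1}<\cdots$; a path $v_0,\ldots,v_h$ has length $h$. A Bienaymé–Galton–Watson tree with offspring distribution $L$ (with values in $\{0,1,2,\ldots\}$) is the random rooted tree in which each vertex independently has a number of children distributed as $L$. Convention: $\log0=-\infty$. *)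

(* Defs.v *)
From mathcomp Require Import all_boot all_order all_algebra.
From mathcomp Require Import all_classical all_reals all_analysis.

Set Implicit Arguments.
Unset Strict Implicit.
Unset Printing Implicit Defensive.

Import Order.TTheory GRing.Theory Num.Theory.
Local Open Scope classical_set_scope.
Local Open Scope ring_scope.

(* Mutual independence of a family of classes of events: the product rule over
   every finite subfamily. *)
Definition mutually_independent {d} {Omega : measurableType d} {R : realType}
    (P : probability Omega R) {I : choiceType}
    (F : I -> set (set Omega)) : Prop :=
  forall (s : seq I) (E : I -> set Omega),
    uniq s -> (forall i, i \in s -> F i (E i)) ->
    P (\bigcap_(i in [set` s]) E i) = (\prod_(i <- s) P (E i))%E.

Definition events_of {d d'} {Omega : measurableType d} {T : measurableType d'}
    (X : Omega -> T) : set (set Omega) :=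
  preimage_set_system [set: Omega] X measurable.

Definition has_law {d d'} {Omega : measurableType d} {T : measurableType d'}
    {R : realType} {P : probability Omega R}
    (X : {RV P >-> T}) (mu : set T -> \bar R) : Prop :=
  forall A : set T, measurable A -> distribution P X A = mu A.

(* Ulam-Harris encoding: the root is [::] and [rcons u i] is the [i]-th child
   of [u], children being numbered from 0. *)
Definition word := seq nat.
Definition root_word : word := [::].

(* The tree in which each vertex [u] has exactly [n u] children; the value of
   [n] at words outside the tree is irrelevant. *)
Definition plane_tree (n : word -> nat) : set word :=
  [set v | forall (u : word) (i : nat), prefix (rcons u i) v -> (i < n u)%N].

Definition word_adjacent (u v : word) : Prop :=
  exists i, v = rcons u i \/ u = rcons v i.

(* The graph distance from the root to [v] is the length [size v] of the word
   (see [root_dist_attained] and [root_dist_le]). *)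
Definition root_dist (v : word) : nat := size v.

Definition is_walk (T : set word) (p : nat -> word) (k : nat) : Prop :=
  [/\ p 0%N = root_word, forall i, (i <= k)%N -> T (p i) &
      forall i, (i < k)%N -> word_adjacent (p i) (p i.+1)].

Lemma root_dist_attained (n : word -> nat) (v : word) : plane_tree n v ->
  exists2 p, is_walk (plane_tree n) p (root_dist v) & p (root_dist v) = v.
Proof.
move=> Tv; exists (take^~ v); last exact: take_size.
split=> [|i _ u j|i iv]; first exact: take0.
  move=> uj; apply: Tv; apply: prefix_trans uj _; exact: prefix_take.
by exists (nth 0%N v i); left; rewrite (take_nth 0%N).
Qed.

Lemma root_dist_le (T : set word) (p : nat -> word) (k : nat) :
  is_walk T p k -> (root_dist (p k) <= k)%N.
Proof.
move=> [p0 _ padj]; suff: forall i, (i <= k)%N -> (size (p i) <= i)%N by apply.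
elim=> [_|i IH ik]; first by rewrite p0.
have [j [->|e]] := padj _ ik; first by rewrite size_rcons ltnS IH// ltnW.
have := IH (ltnW ik); rewrite e size_rcons => /ltnW/leq_trans; exact.
Qed.

Definition rmf_label {R : realType} (theta : R) (U : word -> R) (v : word) : R :=
  U v + theta * (root_dist v)%:R.

(* [p] restricted to the initial segment [D] of [nat] is a simple path from the
   root of [T] along which [X] strictly increases: [D = `I_h.+1] for a path of
   length [h], [D = setT] for an infinite path. *)
Definition increasing_path {R : realType} (T : set word) (X : word -> R)
    (D : set nat) (p : nat -> word) : Prop :=
  [/\ p 0%N = root_word,
      forall i, D i -> T (p i),
      forall i, D i.+1 -> word_adjacent (p i) (p i.+1),
      set_inj D p &
      forall i, D i.+1 -> X (p i) < X (p i.+1)].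

Definition has_infinite_increasing_path {R : realType} (T : set word)
    (X : word -> R) : Prop :=
  exists p, increasing_path T X setT p.

Definition has_long_increasing_path {R : realType} (T : set word)
    (X : word -> R) (h : nat) : Prop :=
  exists2 k, (h <= k)%N & exists p, increasing_path T X `I_k.+1 p.

(* [N v] is the number of children of [v] if [v] is in the tree, and [U v] its
   uniform variable. Both are defined on all words, so the joint independence
   below yields a Bienayme-Galton-Watson tree with i.i.d. marks independent of
   it. *)
Definition bgw_rmf {d} {Omega : measurableType d} {R : realType}
    {P : probability Omega R} (L : probability nat R)
    (N : word -> {RV P >-> nat}) (U : word -> {RV P >-> R}) : Prop :=
  [/\ forall v, has_law (N v) L,
      forall v, has_law (U v) (uniform_prob (@ltr01 R)) &
      mutually_independent P (fun i : word + word =>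
        match i with
        | inl v => events_of (N v)
        | inr v => events_of (U v)
        end)].

(* Main.v *)
Require Import Defs.
From mathcomp Require Import all_boot all_order all_algebra.
From mathcomp Require Import all_classical all_reals all_analysis.
From mathcomp Require Import measurable_realfun.
From mathcomp Require Import zify ring lra.

Set Implicit Arguments.
Unset Strict Implicit.
Unset Printing Implicit Defensive.

Import Order.TTheory GRing.Theory Num.Theory.
Import numFieldNormedType.Exports.
Local Open Scope classical_set_scope.
Local Open Scope ring_scope.

(** The proof is a first moment bound.  A path that increases from the root can
    only go down the tree, so an increasing path of length [h] is a word [v] of
    length [h] whose prefixes lie in the tree and carry increasing labels.  The
    expected number of tree words of length [h] is [m ^+ h], so everything
    rests on the probability that independent uniform variables satisfy
    [U_i < U_(i+1) + theta] for all [i < h].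

    For a start at height [u] this probability [q_h u] satisfies
    [q_(h+1) u <= \int_(u - theta)^1 q_h].  If [q_h u <= C e^(- lam u)], the
    integral is at most [C (e^(lam theta) e^(- lam u) - e^(- lam)) / lam], so
    each step costs a factor strictly below [e^(lam theta) / lam], whatever
    [lam > 0].  The strictness comes from the upper limit [1] of the integral,
    and it is what settles the critical value [theta = 1 / (e m)]: with
    [lam = e m] the factor is less than [1 / m], the expected number of
    increasing words of length [h] decays geometrically, and an infinite path
    has probability zero.  With [lam = 1 / theta] the factor is [e theta], which
    gives the limsup; if [theta = 0], all values of [lam] are used and the bound
    tends to minus infinity.

    Independence is only given as a product rule on events, so the integral
    operator is replaced by a matrix.  The line is cut into [K] cells of uniform
    mass at most [1 / K]; the labels can increase along a word only if the cell
    numbers satisfy [b_i <= b_(i+1) + s] with [s] close to [theta K].  This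
    covers the event by boxes to which the product rule applies, and the
    strict gain above absorbs the discretisation error once [K] is large
    ([transfer_rate]).  The bound for long paths is [long_path_probability_le];
    Koenig's lemma, in [has_infinite_increasing_pathE], turns the infinite path
    event into a countable intersection of long path events, which makes it
    measurable. *)

(** * Weighted counts of words *)

Fixpoint words (K h : nat) : seq word :=
  if h is h'.+1 then [seq b :: t | b <- index_iota 0 K, t <- words K h']
  else [:: [::]].

Lemma mem_words K h v :
  (v \in words K h) = (size v == h) && all (fun b => b < K)%N v.
Proof.
elim: h v => [|h IH] [|b v] //=.
  by apply/allpairsP => -[[b t]] /= [].
rewrite eqSS andbCA -IH; apply/allpairsP/andP.
  by move=> [[c t]] /= [+ tw [-> ->]]; rewrite mem_index_iota.
by move=> [bK vw]; exists (b, v); rewrite /= mem_index_iota.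
Qed.

Lemma sum_prod_words (R : comPzSemiRingType) K h (f : nat -> R) :
  \sum_(v <- words K h) \prod_(i <- v) f i = (\sum_(0 <= i < K) f i) ^+ h.
Proof.
elim: h => [|h IH]; first by rewrite big_seq1 big_nil.
rewrite big_allpairs_dep exprS -IH mulr_suml; apply: eq_bigr => b _.
by rewrite mulr_sumr; apply: eq_bigr => t _; rewrite big_cons.
Qed.

Definition cell_rel (s b b' : nat) : bool := (b <= b' + s)%N.

(** The left-hand sum is the [h]-th power of the matrix with entries [c] on the
    pairs in [cell_rel s], applied to the constant vector [1]: if
    [b |-> a ^+ b] is a subsolution of rate [rho] and dominates [1] up to [C],
    the bound propagates by induction on [h]. *)
Lemma sum_path_words (R : realFieldType) K s (c a C rho : R) h b :
  0 <= c -> (b < K)%N ->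
  (forall b, (b < K)%N ->
     \sum_(0 <= b' < K | cell_rel s b b') c * a ^+ b' <= rho * a ^+ b) ->
  (forall b, (b < K)%N -> 1 <= C * a ^+ b) -> 0 <= C -> 0 <= rho ->
  \sum_(t <- words K h | path (cell_rel s) b t) c ^+ h <= C * rho ^+ h * a ^+ b.
Proof.
move=> c0 + step init C0 rho0.
elim: h b => [|h IH] b bK; first by rewrite big_mkcond big_seq1/= mulr1 init.
rewrite big_mkcond big_allpairs_dep/=.
apply: (@le_trans _ _ (\sum_(0 <= b' < K | cell_rel s b b')
    c * (C * rho ^+ h * a ^+ b'))); last first.
  under eq_bigr do rewrite mulrCA.
  by rewrite -mulr_sumr exprSr mulrA -!mulrA !ler_wpM2l ?exprn_ge0 ?step.
rewrite [leRHS]big_mkcond/= !big_nat; apply: ler_sum => b' /andP[_ b'K].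
case: ifPn => bb' /=; last by rewrite big1.
rewrite -big_mkcond/=; under eq_bigr do rewrite exprS.
by rewrite -mulr_sumr ler_wpM2l// IH.
Qed.

Lemma sum_sorted_words (R : realFieldType) K s (c a C rho : R) h :
  0 <= c -> c * K%:R <= 1 -> 0 <= a <= 1 ->
  (forall b, (b < K)%N ->
     \sum_(0 <= b' < K | cell_rel s b b') c * a ^+ b' <= rho * a ^+ b) ->
  (forall b, (b < K)%N -> 1 <= C * a ^+ b) -> 0 <= C -> 0 <= rho ->
  \sum_(t <- words K h.+1 | sorted (cell_rel s) t) c ^+ h.+1 <= C * rho ^+ h.
Proof.
move=> c0 cK /andP[a0 a1] step init C0 rho0.
have Crho : 0 <= C * rho ^+ h by rewrite mulr_ge0// exprn_ge0.
apply: (@le_trans _ _ (\sum_(0 <= b < K) c * (C * rho ^+ h))); last first.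
  rewrite sumr_const_nat subn0 -mulrnAl -mulr_natr -[leRHS]mul1r.
  exact: ler_wpM2r.
rewrite big_mkcond big_allpairs_dep/= !big_nat; apply: ler_sum => b /andP[_ bK].
rewrite -big_mkcond/=; under eq_bigr do rewrite exprS.
rewrite -mulr_sumr ler_wpM2l//.
apply: (le_trans (sum_path_words h c0 bK step init C0 rho0)).
by rewrite ler_piMr// exprn_ile1.
Qed.

Arguments words : simpl never.

(** * The decay rate of the transfer matrix *)

Lemma geometric_tail (R : comPzRingType) (a : R) c n :
  (1 - a) * (\sum_(0 <= j < n | (c <= j)%N) a ^+ j) = a ^+ c - a ^+ maxn c n.
Proof.
elim: n => [|n IH]; first by rewrite big_nil mulr0 maxn0 subrr.
rewrite big_mkcond big_nat_recr//= -big_mkcond/= mulrDr IH.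
have [cn|cn] := boolP (c <= n)%N.
  by rewrite (maxn_idPr cn) (maxn_idPr (leqW cn)) exprS; ring.
rewrite -ltnNge in cn.
by rewrite mulr0 addr0 (maxn_idPl (ltnW cn)) (maxn_idPl cn).
Qed.

(** The weights [a ^+ b] discretise [e^(- lam u)] at [u = b / K], and [s] rounds
    [theta K] up by at most one cell.  By summing a geometric series, the rate
    is [(e^(lam theta + y) - e^(- lam)) / (K (1 - e^(- y)))] at mesh
    [y = lam / K]; as [y] tends to [0] this tends to
    [(e^(lam theta) - e^(- lam)) / lam], which leaves room for a strict
    inequality at some finite [K]. *)
Lemma transfer_rate (R : realType) (lam theta : R) : 0 < lam -> 0 <= theta ->
  exists K : nat, exists rho : R,
   let a := expR (- (lam / K%:R)) in let s := (Num.truncn (theta * K%:R)).+1 in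
   [/\ (0 < K)%N, 0 <= rho, rho < expR (lam * theta) / lam,
     forall b, (b < K)%N -> 1 <= expR lam * a ^+ b &
     forall b, (b < K)%N ->
     \sum_(0 <= b' < K | cell_rel s b b') K%:R^-1 * a ^+ b' <= rho * a ^+ b].
Proof.
move=> lam0 theta0.
set A := expR (lam * theta); set B := expR (- lam).
have A1 : 1 <= A by rewrite /A leNgt expR_lt1 -leNgt mulr_ge0// ltW.
have B0 : 0 < B by exact: expR_gt0.
have B1 : B < 1 by rewrite expR_lt1 oppr_lt0.
(* The mesh [y = lam / K] must satisfy [4 A y < B]: this is what makes
   [(1 + y) (A e^y - B) < A], given [e^y <= 1 + 2 y]. *)
pose K := (Num.truncn (4 * A * lam / B)).+1.
have K0 : 0 < K%:R :> R by rewrite ltr0n.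
pose y := lam / K%:R.
have y0 : 0 < y by rewrite divr_gt0.
have yAB : 4 * A * y < B.
  have : 4 * A * lam / B < K%:R by exact: truncnS_gt.
  rewrite /y mulrA !ltr_pdivrMr//. by rewrite [B * _]mulrC.
have y4 : y < 1/4 by nra.
have ey1 : 1 + y <= expR y by exact: expR_ge1Dx.
have ey2 : expR y * (1 - y) <= 1.
  have := expR_ge1Dx (- y); rewrite expRN => h.
  by rewrite -ler_pdivlMl ?expR_gt0// mulr1.
exists K, ((1 + y) * (A * expR y - B) / lam); split => //.
- by apply: divr_ge0; [apply: mulr_ge0; nra | exact: ltW].
- rewrite ltr_pM2r ?invr_gt0//.
  have e2 : expR y <= 1 + 2 * y by nra.
  have : (1 + y) * (A * expR y) <= (1 + y) * (A * (1 + 2 * y)).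
    by rewrite ler_pM2l ?ler_pM2l//; lra.
  nra.
- move=> b bK; rewrite -expRM_natl -expRD leNgt expR_lt1 -leNgt.
  rewrite mulrN subr_ge0 mulrA ler_pdivrMr// mulrC ler_pM2l// ler_nat ltnW//.
move=> b bK; set a := expR _; set s := _.+1.
have a0 : 0 < a by exact: expR_gt0.
have a1 : a < 1 by rewrite expR_lt1 oppr_lt0.
have aX n : a ^+ n = expR (- (y * n%:R)) by rewrite -expRM_natl mulrN mulrC.
have aK : a ^+ K = B by rewrite aX /y divfK ?gt_eqF.
rewrite -mulr_sumr (eq_bigl (fun b' => (b - s <= b')%N)); last first.
  by move=> b'; rewrite /cell_rel leq_subLR addnC.
have := geometric_tail a (b - s) K.
rewrite (maxn_idPr (leq_trans (leq_subr _ _) (ltnW bK))) aK.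
set S := \sum_(0 <= _ < _ | _) _ => eS.
have eSle : (1 - a) * S <= (A * expR y - B) * a ^+ b.
  rewrite eS mulrBl lerB//; last by rewrite ler_piMr ?exprn_ile1 ?ltW.
  rewrite !aX -!expRD ler_expR.
  have sK : s%:R <= theta * K%:R + 1.
    by rewrite -natr1 lerD2r truncn_le mulr_ge0// ltW.
  have bs : b%:R <= (b - s)%:R + s%:R :> R.
    by rewrite -natrD ler_nat addnC -leq_subLR.
  have : y * b%:R <= y * ((b - s)%:R + (theta * K%:R + 1)).
    by rewrite ler_pM2l//; lra.
  rewrite (_ : y * (_ + _) = y * (b - s)%:R + lam * theta + y); first by lra.
  by rewrite /y; field; rewrite gt_eqF.
(* [1 + y <= e^y] bounds the normalisation [K (1 - a)] from below. *)
have ay : y <= (1 - a) * (1 + y).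
  have : a * (1 + y) <= 1.
    by rewrite /a expRN -/y mulrC ler_pdivrMr ?expR_gt0// mul1r.
  nra.
have S0 : 0 <= S by apply: sumr_ge0 => j _; rewrite exprn_ge0// ltW.
rewrite mulrAC ler_pdivlMr// (_ : _ * S * lam = y * S); last by rewrite /y; ring.
apply: (le_trans (ler_wpM2r S0 ay)).
rewrite [(1 - a) * _]mulrC -!mulrA ler_wpM2l//; lra.
Qed.

(** * Increasing paths as words *)

Lemma plane_treeP (n : word -> nat) (v : word) :
  plane_tree n v <->
  forall j, (j < size v)%N -> (nth 0 v j < n (take j v))%N.
Proof.
split=> [Tv j jv|Tv u i /prefixP[t vE]].
  by apply: Tv; rewrite -take_nth//; exact: prefix_take.
have := Tv (size u); rewrite vE size_cat size_rcons ltnS leq_addr.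
by rewrite -cats1 -!catA nth_cat ltnn subnn/= take_size_cat//; exact.
Qed.

Definition increasing_word {R : realType} (n : word -> nat) (X : word -> R)
    (v : word) : Prop :=
  plane_tree n v /\
  forall j, (j < size v)%N -> X (take j v) < X (take j.+1 v).

Lemma increasing_word_take {R : realType} n (X : word -> R) v k :
  increasing_word n X v -> increasing_word n X (take k v).
Proof.
move=> [/plane_treeP Tv Xv].
have minl j : (j < size (take k v))%N -> (j < k)%N /\ (j < size v)%N.
  by rewrite size_take_min leq_min => /andP.
split.
  by apply/plane_treeP => j /minl[jk jv]; rewrite nth_take// take_takel ?Tv// ltnW.
by move=> j /minl[jk jv]; rewrite !take_takel ?Xv// ltnW.
Qed.

(** A step towards the root would return to the vertex visited just before,
    since a word has only one parent; a simple path never does so. *)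
Lemma increasing_path_descends {R : realType} (T : set word) (X : word -> R)
    (D : set nat) p : (forall i, D i.+1 -> D i) -> increasing_path T X D p ->
  forall i, D i.+1 -> exists k, p i.+1 = rcons (p i) k.
Proof.
move=> dD [p0 _ padj pinj _]; elim=> [|i IH] Di.
  have [k [->|]] := padj _ Di; first by exists k.
  by rewrite p0 => /(congr1 size); rewrite size_rcons.
have [k [->|pE]] := padj _ Di; first by exists k.
have [l] := IH (dD _ Di); rewrite pE => /rcons_inj[pe _].
have : i.+2 = i by apply: pinj; rewrite ?inE//; exact/dD/dD.
by move/eqP; rewrite gtn_eqF// ltnW.
Qed.

Lemma increasing_path_word {R : realType} n (X : word -> R) (D : set nat) p h :
  (forall i, D i.+1 -> D i) -> increasing_path (plane_tree n) X D p -> D h ->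
  size (p h) = h /\ increasing_word n X (p h).
Proof.
move=> dD pP; have desc := increasing_path_descends dD pP.
have [p0 pT _ _ pX] := pP.
have szp i : D i -> size (p i) = i.
  elim: i => [|i IH] Di; first by rewrite p0.
  by have [k ->] := desc _ Di; rewrite size_rcons IH//; exact: dD.
elim: h => [|h IH] Dh.
  by split; [rewrite p0|split; [exact: pT|rewrite p0]].
split; first exact: szp.
have [sh [_ Xh]] := IH (dD _ Dh).
split; first exact: pT.
have [k pE] := desc _ Dh.
have ptake j : (j <= h)%N -> take j (p h.+1) = take j (p h).
  by move=> jh; rewrite pE -cats1 takel_cat ?sh.
move=> j; rewrite szp// ltnS leq_eqVlt => /predU1P[->|jh].
  rewrite ptake// (@take_oversize _ h.+1) ?szp// take_oversize ?sh//.
  exact: pX.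
by rewrite !ptake// ?Xh ?sh// ltnW.
Qed.

Lemma increasing_word_path {R : realType} n (X : word -> R) v :
  increasing_word n X v ->
  increasing_path (plane_tree n) X `I_(size v).+1 (take^~ v).
Proof.
move=> vP; split=> /=.
- exact: take0.
- by move=> i _; exact: (increasing_word_take i vP).1.
- by move=> i iv; exists (nth 0 v i); left; rewrite (take_nth 0).
- move=> i j; rewrite !inE /= !ltnS => iv jv /(congr1 size).
  by rewrite !size_takel.
- by move=> i iv; apply: vP.2.
Qed.

(** Along a path from the root the [i]-th vertex is the prefix of length [i] of
    all later ones, so a path is determined by its last vertex. *)
Lemma has_long_increasing_pathE {R : realType} n (X : word -> R) h :
  has_long_increasing_path (plane_tree n) X h <->
  exists v, size v = h /\ increasing_word n X v.
Proof.
split=> [[k hk [p pP]]|[v [<- vP]]].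
  exists (p h); apply: (increasing_path_word _ pP) => //=.
  by move=> i; rewrite !ltnS; exact: ltnW.
exists (size v) => //; exists (take^~ v); exact: increasing_word_path.
Qed.

(** Koenig's lemma.  The vertices that start arbitrarily long increasing words
    form a subtree without leaves: if every child of [u] had bounded
    extensions, the maximum over the finitely many children would bound those
    of [u].  The infinite path picks such a child at each step. *)
Lemma has_infinite_increasing_pathE {R : realType} n (X : word -> R) :
  has_infinite_increasing_path (plane_tree n) X <->
  forall h, has_long_increasing_path (plane_tree n) X h.
Proof.
split=> [[p pP] h|long].
  apply/has_long_increasing_pathE; exists (p h).
  exact: (increasing_path_word _ pP).
pose ext u := forall h, exists v,
  [/\ prefix u v, (h <= size v)%N & increasing_word n X v].
have ext0 : ext [::].
  move=> h; have /has_long_increasing_pathE[v [vh vP]] := long h.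
  by exists v; rewrite prefix0s vh.
have next u : ext u -> exists i, ext (rcons u i).
  move=> uP; apply: contrapT => /forallNP no.
  have {no} /choice[g gP] : forall i, exists h, forall v,
      prefix (rcons u i) v -> increasing_word n X v -> (size v < h)%N.
    move=> i; have /existsNP[h hP] := no i; exists h => v uv vP.
    by rewrite ltnNge; apply/negP => hv; apply: hP; exists v.
  have [v [/prefixP[t vE] vh vP]] :=
    uP (maxn (size u).+1 (\max_(i < n u) g i)).
  move: vh; rewrite geq_max => /andP[uv gv].
  case: t vE => [vE|i t vE]; first by move: uv; rewrite vE cats0 ltnn.
  have uiv : prefix (rcons u i) v by rewrite vE -cat_rcons prefix_prefix.
  have iu : (i < n u)%N by exact: vP.1.
  have := gP _ _ uiv vP; rewrite ltnNge => /negP; apply.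
  exact: leq_trans (leq_bigmax (Ordinal iu)) gv.
have /choice[c cP] : forall u, exists i, ext u -> ext (rcons u i).
  move=> u; have [/next[i]|nu] := pselect (ext u); first by exists i.
  by exists 0%N.
pose p := fix p k := if k is k'.+1 then rcons (p k') (c (p k')) else [::].
have pext k : ext (p k) by elim: k => //= k /cP.
have szp k : size (p k) = k by elim: k => //= k IH; rewrite size_rcons IH.
have pP k : increasing_word n X (p k).
  have [v [/prefixP[t vE] _]] := pext k 0%N.
  by move=> /(increasing_word_take (size (p k))); rewrite vE take_size_cat.
exists p; split=> //.
- by move=> i _; exact: (pP i).1.
- by move=> i _; exists (c (p i)); left.
- by move=> i j _ _ /(congr1 size); rewrite !szp.
- move=> i _; have := (pP i.+1).2 i; rewrite szp ltnSn => /(_ isT).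
  rewrite (@take_oversize _ i.+1) ?szp//.
  have -> : take i (p i.+1) = p i by rewrite /= -cats1 takel_cat ?szp// take_oversize ?szp.
  by [].
Qed.

(** * Cells of the line *)

(** The first and last cells are unbounded, so that the cells cover the whole
    line and no null set has to be removed from the sample space. *)
Definition cell {R : realType} (K b : nat) : interval R :=
  Interval (if b == 0%N then -oo%O else BLeft (b%:R / K%:R))
           (if b.+1 == K then +oo%O else BLeft (b.+1%:R / K%:R)).

Lemma in_cell {R : realType} (K b : nat) (x : R) : x \in cell K b =
  ((b == 0%N) || (b%:R / K%:R <= x)) && ((b.+1 == K) || (x < b.+1%:R / K%:R)).
Proof. by rewrite itv_boundlr /=; case: eqP => _; case: eqP => _. Qed.

Lemma cell_cover {R : realType} (K : nat) (x : R) : (0 < K)%N ->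
  exists b, (b < K)%N /\ x \in cell K b.
Proof.
move=> K0; have K0R : 0 < K%:R :> R by rewrite ltr0n.
have [x0|x0] := ltP x 0.
  exists 0%N; split=> //; rewrite in_cell/=; apply/orP; right.
  by rewrite (lt_le_trans x0)// divr_ge0.
have Kx0 : 0 <= x * K%:R by rewrite mulr_ge0// ltW.
have [tK|Kt] := ltnP (Num.truncn (x * K%:R)) K.
  exists (Num.truncn (x * K%:R)); split=> //; rewrite in_cell.
  rewrite ler_pdivrMr// truncn_le Kx0 orbT/=.
  by rewrite ltr_pdivlMr// truncnS_gt orbT.
exists K.-1; rewrite in_cell prednK// eqxx leqnn andbT; split=> //.
rewrite ler_pdivrMr//; apply/orP; right.
rewrite (@le_trans _ _ K%:R)// ?ler_nat ?leq_pred//.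
by rewrite -truncn_ge_nat.
Qed.

(** The unbounded cells do no harm: a constraint is needed only from the lower
    end of the cell of [x] and the upper end of the cell of [y], and where one
    of them is infinite the conclusion is trivial. *)
Lemma cell_step {R : realType} (K b b' : nat) (theta x y : R) :
  (b < K)%N -> (b' < K)%N -> 0 <= theta ->
  x \in cell K b -> y \in cell K b' -> x < y + theta ->
  cell_rel (Num.truncn (theta * K%:R)).+1 b b'.
Proof.
move=> bK b'K theta0; rewrite !in_cell /cell_rel.
have K0 : 0 < K%:R :> R by rewrite ltr0n (leq_trans _ bK).
move=> /andP[/predU1P[->//|bx] _] /andP[_ /predU1P[bE|yb]] xy.
  by rewrite (leq_trans _ (leq_addr _ _))// -ltnS bE.
rewrite addnS -addSn -ltnS -(ltr_nat R) -addnS natrD.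
have tK : theta * K%:R < (Num.truncn (theta * K%:R)).+1%:R by exact: truncnS_gt.
rewrite ler_pdivrMr// in bx; rewrite ltr_pdivlMr// in yb.
have : x * K%:R < (y + theta) * K%:R by rewrite ltr_pM2r.
by rewrite mulrDl; lra.
Qed.

Lemma uniform_cell {R : realType} (K b : nat) : (b < K)%N ->
  (uniform_prob (@ltr01 R) [set` cell K b] <= (K%:R^-1)%:E)%E.
Proof.
move=> bK; have K0 : 0 < K%:R :> R by rewrite ltr0n (leq_trans _ bK).
pose J : set R := [set` `[b%:R / K%:R, b.+1%:R / K%:R]].
have mc : measurable ([set` cell K b] : set R) by exact: measurable_itv.
apply: (@le_trans _ _
  (\int[lebesgue_measure]_(x in [set` cell K b]) (\1_J x)%:E)%E).
  apply: ge0_le_integral => //.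
  - by move=> x _; rewrite lee_fin; apply: uniform_pdf_ge0; exact: ltr01.
  - apply/measurable_EFinP; apply: measurable_funTS.
    exact: measurable_uniform_pdf.
  - apply/measurable_EFinP; apply: measurable_indic; exact: measurable_itv.
  move=> x /= xc; rewrite lee_fin indicE /uniform_pdf.
  case: ifPn => // /andP[x0 x1]; rewrite subr0 invr1.
  suff -> : x \in J by [].
  move: xc; rewrite in_cell inE /J /= in_itv/= => /andP[xl xr]; apply/andP; split.
    by move: xl => /predU1P[->|//]; rewrite mul0r.
  move: xr => /predU1P[->|/ltW//]; by rewrite divff ?gt_eqF.
rewrite integral_indic//; last exact: measurable_itv.
apply: (@le_trans _ _ (lebesgue_measure J)).
  apply: le_measure; rewrite ?inE//; last exact: measurable_itv.
  by apply: measurableI => //; exact: measurable_itv.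
rewrite lebesgue_measure_itv/=; case: ifPn => _.
  by rewrite -EFinB lee_fin -natr1 mulrDl mul1r addrAC subrr add0r.
by rewrite lee_fin invr_ge0 ltW.
Qed.

(** * Offspring tails *)

Definition tail_prob {R : realType} (L : probability nat R) (i : nat) : R :=
  fine (L [set k | (i < k)%N]).

Lemma tail_probE {R : realType} (L : probability nat R) (i : nat) :
  L [set k | (i < k)%N] = (tail_prob L i)%:E.
Proof. by rewrite /tail_prob fineK// fin_num_measure. Qed.

Lemma tail_prob_ge0 {R : realType} (L : probability nat R) (i : nat) :
  0 <= tail_prob L i.
Proof. exact: fine_ge0. Qed.

(** The truncated mean [minn k M] is the number of [i < M] with [i < k]. *)
Lemma sum_tail_prob_le {R : realType} (L : probability nat R) (m : R) (M : nat) :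
  (\int[L]_k (k%:R)%:E = m%:E)%E -> \sum_(0 <= i < M) tail_prob L i <= m.
Proof.
move=> Lm; rewrite -lee_fin -Lm -sumEFin.
under eq_bigr do rewrite -tail_probE -[X in L X]setIT -integral_indic//.
rewrite -ge0_integral_sum//.
apply: ge0_le_integral => //.
- by move=> k _; apply: sume_ge0.
move=> k _; rewrite sumEFin lee_fin.
have -> : \sum_(0 <= i < M) \1_[set k | (i < k)%N] k = (minn k M)%:R :> R.
  elim: M => [|M IH]; first by rewrite big_nil minn0.
  rewrite big_nat_recr//= IH indicE mem_setE -natrD.
  by congr _%:R; case: (ltnP M k) => /=; lia.
by rewrite ler_nat geq_minl.
Qed.

(** * Probability of long increasing paths *)

Lemma measure_big_setU_le {d} {T : measurableType d} {R : realType}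
    (mu : {measure set T -> \bar R}) (I : Type) (s : seq I) (A : I -> set T) :
  (forall i, measurable (A i)) ->
  (mu (\big[setU/set0]_(i <- s) A i) <= \sum_(i <- s) mu (A i))%E.
Proof.
move=> mA; elim: s => [|i s IH]; first by rewrite !big_nil measure0.
rewrite !big_cons; apply: le_trans (leeD2l _ IH).
by apply: measureU2 => //; exact: bigsetU_measurable.
Qed.

(** The indices of the variables that decide whether [v] is an increasing word:
    offspring numbers at the proper prefixes of [v], uniform marks at all
    prefixes. *)
Definition addresses (v : word) : seq (word + word) :=
  [seq inl (take i v) | i <- iota 0 (size v)] ++
  [seq inr (take i v) | i <- iota 0 (size v).+1].

Lemma addresses_uniq (v : word) : uniq (addresses v).
Proof.
have take_inj i j : (i <= size v)%N -> (j <= size v)%N ->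
    take i v = take j v -> i = j.
  by move=> iv jv /(congr1 size); rewrite !size_takel.
rewrite cat_uniq; apply/and3P; split.
- rewrite map_inj_in_uniq ?iota_uniq// => i j; rewrite !mem_iota/= => iv jv [].
  by apply: take_inj; exact: ltnW.
- by apply/hasPn => _ /mapP[i _ ->]; apply/mapP => -[].
- rewrite map_inj_in_uniq ?iota_uniq// => i j; rewrite !mem_iota/= => iv jv [].
  exact: take_inj.
Qed.

(** The box of [v] and of a cell sequence [beta].  The address of a prefix tells
    its depth through its size, so one family of events indexed by all words
    serves for the product rule. *)
Definition branch_event {d} {Omega : measurableType d} {R : realType}
    {P : probability Omega R} (N : word -> {RV P >-> nat})
    (U : word -> {RV P >-> R}) (K : nat) (v beta : word) (i : word + word) :
    set Omega :=
  match i with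
  | inl u => N u @^-1` [set k | (nth 0 v (size u) < k)%N]
  | inr u => U u @^-1` [set` cell K (nth 0%N beta (size u))]
  end.

Lemma measurable_branch_event {d} {Omega : measurableType d} {R : realType}
    {P : probability Omega R} (N : word -> {RV P >-> nat})
    (U : word -> {RV P >-> R}) (K : nat) (v beta : word) (i : word + word) :
  measurable (branch_event N U K v beta i).
Proof. by case: i => u /=; rewrite -[X in measurable X]setTI; apply: measurable_funPT. Qed.

Lemma branch_probability_le {d} {Omega : measurableType d} {R : realType}
    {P : probability Omega R} (L : probability nat R)
    (N : word -> {RV P >-> nat}) (U : word -> {RV P >-> R})
    (K : nat) (v beta : word) :
  bgw_rmf L N U -> size beta = (size v).+1 -> all (fun b => b < K)%N beta ->
  (P (\bigcap_(i in [set` addresses v]) branch_event N U K v beta i) <=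
   ((\prod_(i <- v) tail_prob L i) * K%:R^-1 ^+ (size v).+1)%:E)%E.
Proof.
move=> [NL UU indep] sb bK.
rewrite indep ?addresses_uniq//; last first.
  by move=> [u|u] _ /=; eexists; rewrite ?setTI; [|reflexivity|
    |reflexivity]; rewrite //; exact: measurable_itv.
rewrite big_cat !big_map EFinM; apply: lee_pmul.
- by apply: prode_ge0.
- by apply: prode_ge0.
- rewrite -prodEFin [leRHS](big_nth 0%N) /index_iota subn0 le_eqVlt; apply/orP; left.
  apply/eqP; apply: eq_big_seq => i; rewrite mem_iota /= => iv.
  by rewrite size_takel ?(ltnW iv)// -tail_probE -(NL (take i v)).
have -> : (K%:R^-1 ^+ (size v).+1)%:E =
    (\prod_(i <- iota 0 (size v).+1) (K%:R^-1)%:E)%E :> \bar R.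
  by rewrite prodEFin big_const_seq count_predT size_iota iter_mulr_1.
apply: (@proj2 (0 <= \prod_(i <- iota 0 (size v).+1)
  P (branch_event N U K v beta (inr (take i v))))%E).
rewrite !big_seq; elim/big_ind2: _ => //.
  by move=> x1 y1 x2 y2 [x10 xy1] [x20 xy2]; split; [exact: mule_ge0|exact: lee_pmul].
move=> i; rewrite mem_iota/= ltnS => iv; split=> //.
rewrite size_takel// -[leLHS]/(distribution P (U (take i v)) _).
rewrite (UU (take i v)); last exact: measurable_itv.
apply: uniform_cell; apply: (allP bK); apply: mem_nth.
by rewrite sb ltnS.
Qed.

Definition increasing_event {d} {Omega : measurableType d} {R : realType}
    {P : probability Omega R} (N : word -> {RV P >-> nat})
    (U : word -> {RV P >-> R}) (theta : R) (v : word) : set Omega :=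
  [set w | increasing_word (fun v => N v w) (rmf_label theta (fun v => U v w)) v].

Lemma measurable_increasing_event {d} {Omega : measurableType d} {R : realType}
    {P : probability Omega R} (N : word -> {RV P >-> nat})
    (U : word -> {RV P >-> R}) (theta : R) (v : word) :
  measurable (increasing_event N U theta v).
Proof.
have -> : increasing_event N U theta v = \bigcap_(j in `I_(size v))
    ((N (take j v) @^-1` [set k | (nth 0 v j < k)%N]) `&`
     [set w | rmf_label theta (fun v => U v w) (take j v) <
              rmf_label theta (fun v => U v w) (take j.+1 v)]).
  apply/seteqP; split=> w.
    by move=> [/plane_treeP Tv Xv] j jv; split; [exact: Tv|exact: Xv].
  move=> jP; split; last by move=> j /jP[].
  by apply/plane_treeP => j /jP[].
apply: bigcap_measurableType => j _; apply: measurableI.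
  by rewrite -[X in measurable X]setTI; exact: measurable_funPT.
rewrite -[X in measurable X]setTI.
have : measurable_fun setT (fun w =>
    rmf_label theta (fun v => U v w) (take j v) <
    rmf_label theta (fun v => U v w) (take j.+1 v)).
  by apply: measurable_fun_ltr; apply: measurable_funD.
by move=> /(_ measurableT [set true]); apply.
Qed.

(** Along increasing labels [U_i < U_(i+1) + theta], because consecutive depths
    differ by one; hence the cells containing the marks form a sequence sorted
    for [cell_rel]. *)
Lemma increasing_event_cover {d} {Omega : measurableType d} {R : realType}
    {P : probability Omega R} (N : word -> {RV P >-> nat})
    (U : word -> {RV P >-> R}) (theta : R) (K : nat) (v : word) :
  (0 < K)%N -> 0 <= theta ->
  increasing_event N U theta v `<=`
  \big[setU/set0]_(beta <- [seq beta <- words K (size v).+1 |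
      sorted (cell_rel (Num.truncn (theta * K%:R)).+1) beta])
    \bigcap_(i in [set` addresses v]) branch_event N U K v beta i.
Proof.
move=> K0 theta0 w [/plane_treeP Tv Xv].
have /choice[c cP] := fun x : R => cell_cover x K0.
pose beta := [seq c (U (take i v) w) | i <- iota 0 (size v).+1].
have sbeta : size beta = (size v).+1 by rewrite size_map size_iota.
have nth_beta i : (i <= size v)%N -> nth 0%N beta i = c (U (take i v) w).
  by move=> iv; rewrite (nth_map 0%N) ?size_iota// nth_iota.
have bsorted : sorted (cell_rel (Num.truncn (theta * K%:R)).+1) beta.
  apply/(sortedP 0%N) => i; rewrite sbeta ltnS => iv.
  rewrite !nth_beta//; last exact: ltnW.
  have [ciK ci] := cP (U (take i v) w).
  have [cjK cj] := cP (U (take i.+1 v) w).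
  apply: (cell_step ciK cjK theta0 ci cj).
  have := Xv i iv; rewrite /rmf_label /root_dist !size_takel//; last exact: ltnW.
  by rewrite -natr1 mulrDr mulr1; lra.
have bwords : beta \in words K (size v).+1.
  rewrite mem_words sbeta eqxx.
  by apply/allP => b /mapP[i _ ->]; exact: (cP _).1.
have bmem : beta \in [seq beta <- words K (size v).+1 |
    sorted (cell_rel (Num.truncn (theta * K%:R)).+1) beta].
  by rewrite mem_filter bsorted.
rewrite -bigcup_seq; exists beta; first exact: bmem.
move=> a; rewrite /= mem_cat => /orP[] /mapP[i + ->]; rewrite mem_iota/= => iv.
  by rewrite size_takel; [exact: Tv|exact: ltnW].
by rewrite size_takel// nth_beta//; exact: (cP _).2.
Qed.

Lemma increasing_event_probability_le {d} {Omega : measurableType d}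
    {R : realType} {P : probability Omega R} (L : probability nat R)
    (N : word -> {RV P >-> nat}) (U : word -> {RV P >-> R})
    (theta c : R) (K : nat) (v : word) :
  bgw_rmf L N U -> (0 < K)%N -> 0 <= theta ->
  \sum_(beta <- words K (size v).+1 |
     sorted (cell_rel (Num.truncn (theta * K%:R)).+1) beta)
     K%:R^-1 ^+ (size v).+1 <= c ->
  (P (increasing_event N U theta v) <= ((\prod_(i <- v) tail_prob L i) * c)%:E)%E.
Proof.
move=> bgw K0 theta0 cle.
have mB beta : measurable
    (\bigcap_(i in [set` addresses v]) branch_event N U K v beta i).
  apply: fin_bigcap_measurable; first exact: finite_seq.
  by move=> i _; exact: measurable_branch_event.
apply: le_trans.
  apply: le_measure (increasing_event_cover (K := K) _ theta0) => //.
  - by rewrite inE; exact: measurable_increasing_event.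
  - by rewrite inE; apply: bigsetU_measurable.
apply: le_trans (measure_big_setU_le _ _ mB) _.
rewrite big_filter big_seq_cond.
apply: (@le_trans _ _ (\sum_(beta <- words K (size v).+1 |
     sorted (cell_rel (Num.truncn (theta * K%:R)).+1) beta)
     ((\prod_(i <- v) tail_prob L i) * K%:R^-1 ^+ (size v).+1)%:E)%E).
  rewrite [leRHS]big_seq_cond; apply: lee_sum => beta /andP[+ _].
  rewrite mem_words => /andP[/eqP sb bK].
  exact: branch_probability_le.
rewrite sumEFin lee_fin -mulr_sumr ler_wpM2l//.
by apply: prodr_ge0 => i _; exact: tail_prob_ge0.
Qed.

(** Truncating the alphabet at [M] reduces the union over all words of length
    [h] to finite unions, to be followed by continuity from below. *)
Lemma long_path_setE {d} {Omega : measurableType d} {R : realType}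
    {P : probability Omega R} (N : word -> {RV P >-> nat})
    (U : word -> {RV P >-> R}) (theta : R) (h : nat) :
  [set w | has_long_increasing_path (plane_tree (fun v => N v w))
     (rmf_label theta (fun v => U v w)) h] =
  \bigcup_M \big[setU/set0]_(v <- words M h) increasing_event N U theta v.
Proof.
apply/seteqP; split=> w /=.
  move=> /has_long_increasing_pathE[v [vh vP]].
  exists (\max_(i <- v) i).+1 => //; rewrite -bigcup_seq; exists v => //=.
  rewrite mem_words vh eqxx/=; apply/allP => i iv.
  by rewrite ltnS; exact: leq_bigmax_seq.
move=> [M _]; rewrite -bigcup_seq => -[v /= + vP].
by rewrite mem_words => /andP[/eqP vh _]; apply/has_long_increasing_pathE; exists v.
Qed.

Lemma measurable_long_path {d} {Omega : measurableType d} {R : realType}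
    {P : probability Omega R} (N : word -> {RV P >-> nat})
    (U : word -> {RV P >-> R}) (theta : R) (h : nat) :
  measurable [set w | has_long_increasing_path (plane_tree (fun v => N v w))
     (rmf_label theta (fun v => U v w)) h].
Proof.
rewrite long_path_setE; apply: bigcupT_measurable => M.
by apply: bigsetU_measurable => v _; exact: measurable_increasing_event.
Qed.

(** Summing the branch bounds over words factorises into the [h]-th power of the
    truncated mean times the transfer matrix bound of rate [rho]. *)
Lemma long_path_probability_le {d} {Omega : measurableType d} {R : realType}
    {P : probability Omega R} (L : probability nat R) (m theta lam : R)
    (N : word -> {RV P >-> nat}) (U : word -> {RV P >-> R}) :
  (\int[L]_k (k%:R)%:E = m%:E)%E -> 0 < lam -> 0 <= theta -> bgw_rmf L N U ->
  exists rho, [/\ 0 <= rho, rho < expR (lam * theta) / lam & forall h,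
    (P [set w | has_long_increasing_path (plane_tree (fun v => N v w))
      (rmf_label theta (fun v => U v w)) h] <=
     (expR lam * (m * rho) ^+ h)%:E)%E].
Proof.
move=> Lm lam0 theta0 bgw.
have [K [rho [K0 rho0 rholt init step]]] := transfer_rate lam0 theta0.
exists rho; split=> // h; rewrite long_path_setE.
have mE M : measurable
    (\big[setU/set0]_(v <- words M h) increasing_event N U theta v).
  by apply: bigsetU_measurable => v _; exact: measurable_increasing_event.
apply: (cvge_to_le (nondecreasing_cvg_mu mE _ _)) => //.
- exact: bigcupT_measurable.
- move=> M M' MM'; apply/subsetPset; rewrite -!bigcup_seq.
  apply: bigcup_subset => v /=; rewrite !mem_words => /andP[-> /allP vM].
  by apply/allP => i /vM /leq_trans; apply.
near=> M => /=.
apply: le_trans (measure_big_setU_le _ _ _) _.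
  by move=> v; exact: measurable_increasing_event.
have compat : \sum_(beta <- words K h.+1 |
    sorted (cell_rel (Num.truncn (theta * K%:R)).+1) beta)
    K%:R^-1 ^+ h.+1 <= expR lam * rho ^+ h.
  apply: sum_sorted_words step init _ rho0 => //.
  - by rewrite mulVf// pnatr_eq0 -lt0n.
  - by rewrite expR_ge0 expR_le1 oppr_le0 divr_ge0// ltW.
apply: (@le_trans _ _ (\sum_(v <- words M h)
    ((\prod_(i <- v) tail_prob L i) * (expR lam * rho ^+ h))%:E)%E).
  rewrite big_seq [leRHS]big_seq; apply: lee_sum => v.
  rewrite mem_words => /andP[/eqP vh _].
  by apply: (increasing_event_probability_le bgw K0 theta0); rewrite vh.
rewrite sumEFin lee_fin -mulr_suml sum_prod_words exprMn mulrCA ler_wpM2l ?expR_ge0//.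
rewrite ler_wpM2r ?exprn_ge0// lerXn2r ?nnegrE//.
- by apply: sumr_ge0 => i _; exact: tail_prob_ge0.
- by apply: le_trans (sum_tail_prob_le 0 Lm); rewrite big_nil.
- exact: sum_tail_prob_le.
Unshelve. all: by end_near. Qed.

(** * Exponential rate and conclusion *)

(** The constant [C] contributes [ln C / h], which tends to [0]. *)
Lemma limn_esup_log_le {R : realType} (p : nat -> \bar R) (C r : R) :
  0 < C -> 0 < r -> (forall h, (0 <= p h)%E) ->
  (forall h, (p h <= (C * r ^+ h)%:E)%E) ->
  (limn_esup (fun h : nat => (h%:R^-1)%:E * lne (p h)) <= (ln r)%:E)%E.
Proof.
move=> C0 r0 p0 pC.
pose v (h : nat) : R := h%:R^-1 * ln C + ln r.
have vr : (v h)%:E @[h --> \oo] --> (ln r)%:E.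
  apply/fine_cvgP; split; first by near=> h.
  rewrite -[ln r]add0r -[X in X + _](mul0r (ln C)).
  have inv0 : (h%:R^-1 : R) @[h --> \oo] --> 0.
    by rewrite -cvg_shiftS; exact: cvg_harmonic.
  by apply: cvgD; [exact: cvgM inv0 (cvg_cst _)|exact: cvg_cst].
rewrite -(cvg_limn_einf_sup vr).2 !limn_esup_lim.
apply: lee_lim; [exact: is_cvg_esups|exact: is_cvg_esups|].
near=> n; have n0 : (0 < n)%N by near: n; exists 1%N.
apply/ereal_supP => _ [k /= nk <-].
have k0 : (0 < k)%N by exact: leq_trans nk.
apply: (@le_trans _ _ (v k)%:E); last by apply: ereal_sup_ubound; exists k.
have k0R : 0 < k%:R :> R by rewrite ltr0n.
apply: (@le_trans _ _ ((k%:R^-1)%:E * (ln (C * r ^+ k))%:E)%E).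
  apply: lee_wpmul2l; first by rewrite lee_fin invr_ge0 ltW.
  rewrite -lne_EFin; last by rewrite mulr_gt0// exprn_gt0.
  rewrite lee_lne ?pC// in_itv/= ?leey ?andbT// lee_fin.
  by rewrite mulr_ge0 ?exprn_ge0// ltW.
rewrite -EFinM lee_fin lnM ?posrE ?exprn_gt0// lnXn// mulrDr /v -[ln r *+ k]mulr_natl.
by rewrite mulrA mulVf ?mul1r// gt_eqF.
Unshelve. all: by end_near. Qed.

Theorem proposition1p8 (R : realType) (d : measure_display)
    (Omega : measurableType d) (P : probability Omega R)
    (L : probability nat R) (m theta : R)
    (N : word -> {RV P >-> nat}) (U : word -> {RV P >-> R}) :
  (\int[L]_k (k%:R)%:E = m%:E)%E -> 1 < m ->
  0 <= theta -> theta <= 1 -> theta <= (expR 1 * m)^-1 ->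
  bgw_rmf L N U ->
  let T w := plane_tree (fun v => N v w) in
  let X w := rmf_label theta (fun v => U v w) in
  P [set w | has_infinite_increasing_path (T w) (X w)] = 0%E /\
  (limn_esup (fun h : nat =>
     (h%:R^-1)%:E * lne (P [set w | has_long_increasing_path (T w) (X w) h]))
   <= lne (expR 1 * m * theta)%:E)%E.
Proof.
move=> Lm m1 theta0 _ thetam bgw T X.
have m0 : 0 < m by exact: lt_trans m1.
have em0 : 0 < expR 1 * m by rewrite mulr_gt0 ?expR_gt0.
have mlong h : measurable [set w | has_long_increasing_path (T w) (X w) h].
  exact: measurable_long_path.
have bound lam : 0 < lam -> exists rho, [/\ 0 <= rho,
    rho < expR (lam * theta) / lam & forall h,
    (P [set w | has_long_increasing_path (T w) (X w) h] <=
     (expR lam * (m * rho) ^+ h)%:E)%E].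
  by move=> lam0; exact: long_path_probability_le Lm lam0 theta0 bgw.
split.
  have infE : [set w | has_infinite_increasing_path (T w) (X w)] =
      \bigcap_h [set w | has_long_increasing_path (T w) (X w) h].
    apply/seteqP; split=> w /=.
      by move=> /has_infinite_increasing_pathE wh h _; exact: wh.
    by move=> wh; apply/has_infinite_increasing_pathE => h; exact: wh.
  (* [lam = e m] minimises [e^(lam theta) / lam] at the critical [theta]; for
     smaller [theta] it still gives [e^(lam theta) <= e]. *)
  have [rho [rho0 rholt Ple]] := bound _ em0.
  have mrho : m * rho < 1.
    have eth : expR (expR 1 * m * theta) <= expR 1.
      by rewrite ler_expR -ler_pdivlMl// mulr1.
    move: rholt; rewrite ltr_pdivlMr// => rholt.
    rewrite -(ltr_pM2l (expR_gt0 1)) mulr1; apply: le_lt_trans _ (lt_le_trans rholt eth).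
    by rewrite mulrA [leRHS]mulrC.
  apply/eqP; rewrite eq_le measure_ge0 andbT.
  have cvg0 : (geometric (expR (expR 1 * m)) (m * rho) h)%:E @[h --> \oo] --> 0%:E.
    apply/fine_cvgP; split; first by near=> h.
    by apply: cvg_geometric; rewrite ger0_norm// mulr_ge0// ltW.
  apply: (cvge_to_ge cvg0); near=> h.
  apply: le_trans (Ple h); rewrite infE.
  apply: le_measure; rewrite ?inE//; first exact: bigcapT_measurable.
  by move=> w; exact.
have limsup_le lam : 0 < lam -> (limn_esup (fun h : nat =>
     (h%:R^-1)%:E * lne (P [set w | has_long_increasing_path (T w) (X w) h]))
   <= (ln (m * (expR (lam * theta) / lam)))%:E)%E.
  move=> lam0; have [rho [rho0 rholt Ple]] := bound _ lam0.
  apply: (@limn_esup_log_le _ _ (expR lam)) => //.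
  - exact: expR_gt0.
  - by rewrite mulr_gt0// divr_gt0// expR_gt0.
  move=> h; apply: (le_trans (Ple h)); rewrite lee_fin ler_wpM2l ?expR_ge0//.
  rewrite lerXn2r ?nnegrE ?mulr_ge0 ?invr_ge0 ?expR_ge0 ?(ltW lam0) ?(ltW m0)//.
  by rewrite ler_wpM2l ?ltW.
move: theta0; rewrite le_eqVlt => /predU1P[theta0|theta0].
  rewrite -theta0 mulr0 [leRHS]le0_lneNy// leeNy_eq; apply/eqP; apply: eq_ninfty => A.
  (* For [theta = 0] the rate is [m / lam], here [e^A], with [A] arbitrary. *)
  have lam0 : 0 < m * expR (- A) by rewrite mulr_gt0 ?expR_gt0.
  apply: (le_trans (limsup_le _ lam0)).
  rewrite -theta0 mulr0 expR0 div1r invfM mulrA mulfV ?gt_eqF// mul1r.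
  by rewrite -expRN opprK expRK.
(* [lam = 1 / theta] minimises [e^(lam theta) / lam]. *)
have lam0 : 0 < theta^-1 by rewrite invr_gt0.
apply: (le_trans (limsup_le _ lam0)).
rewrite lne_EFin ?mulr_gt0 ?expR_gt0// mulVf ?gt_eqF// invrK.
by rewrite mulrCA mulrA.
Unshelve. all: by end_near. Qed.
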